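(* There exist absolute constants $C_0,c,A>0$ such that the following holds. Let $G=(V,E)$ be any connected simple graph with $n\ge 2$ nodes, edge connectivity $\lambda$ and minimum degree $\delta$, let $C\ge C_0$, and let $\lambda'=\lfloor\lambda/(C\log n)\rfloor$, assuming $\lambda'\ge 1$. Partition $G$ into $\lambda'$ edge-disjoint subgraphs $G_1=(V,E_1),\ldots,G_{\lambda'}=(V,E_{\lambda'})$ by putting each edge of $G$ in a uniformly random $G_i$, $i\in\{1,\dots,\lambda'\}$, independently. Then, with probability at least $1-n^{-cC}$, for all $i\in\{1,\ldots,\lambda'\}$ the graph $G_i$ is a connected spanning subgraph of $G$ with $\mathrm{diameter}(G_i)\le A\cdot\frac{C\,n\log n}{\delta}$.
   Context: Edge connectivity $\lambda$ is the size of a minimum edge cut of $G$; minimum degree $\delta$ is the minimum number of edges incident to a node. Graphs are undirected and unweighted. The diameter is the maximum over pairs of nodes of the shortest-path distance. *)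

(* Defs.v *)
From HB Require Import structures.
From mathcomp Require Import all_boot all_order all_algebra.
From mathcomp Require Import reals exp.

Set Implicit Arguments.
Unset Strict Implicit.
Unset Printing Implicit Defensive.

Import Order.TTheory GRing.Theory Num.Theory.

Local Open Scope ring_scope.

(* A graph on the vertex set T is given by its set of edges E, an edge being
   the unordered pair of its end points. Edge subsets of E are thus exactly
   the spanning subgraphs (same vertex set T) of E. *)
Definition simple_graph (T : finType) (E : {set {set T}}) : bool :=
  [forall e in E, #|e| == 2%N].

Definition adj (T : finType) (E : {set {set T}}) : rel T :=
  fun x y => [set x; y] \in E.

Definition graph_connected (T : finType) (E : {set {set T}}) : bool :=
  [forall x, forall y, connect (adj E) x y].

Definition degree (T : finType) (E : {set {set T}}) (x : T) : nat :=
  #|[set e in E | x \in e]|.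

(* The default #|E| of the minimum bounds every degree, so it is irrelevant as
   soon as T is nonempty. *)
Definition min_degree (T : finType) (E : {set {set T}}) : nat :=
  (\big[minn/#|E|]_(x : T) degree E x)%N.

Definition edge_cut (T : finType) (E : {set {set T}}) (S : {set T}) :
    {set {set T}} :=
  [set e in E | [exists x in S, exists y in ~: S, e == [set x; y]]].

(* The default #|E| bounds the size of every cut, so it is irrelevant as soon
   as T has two elements. *)
Definition edge_connectivity (T : finType) (E : {set {set T}}) : nat :=
  (\big[minn/#|E|]_(S : {set T} | (S != set0) && (S != setT))
      #|edge_cut E S|)%N.

Definition has_walk (T : finType) (E : {set {set T}}) (k : nat) (x y : T) :
    bool :=
  [exists p : k.-tuple T, path (adj E) x p && (last x p == y)].

(* A shortest walk has fewer than #|T| edges; the default #|T| is the value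
   for pairs lying in different connected components (see distP). *)
Definition dist (T : finType) (E : {set {set T}}) (x y : T) : nat :=
  (\big[minn/#|T|]_(k < #|T| | has_walk E k x y) k)%N.

Definition graph_diameter (T : finType) (E : {set {set T}}) : nat :=
  (\max_(x : T) \max_(y : T) dist E x y)%N.

Definition edge_colouring (T : finType) (E : {set {set T}}) (l : nat) : finType :=
  {ffun {e : {set T} | e \in E} -> 'I_l}.

Definition part (T : finType) (E : {set {set T}}) (l : nat)
    (f : edge_colouring E l) (i : 'I_l) : {set {set T}} :=
  [set val e | e in [set e | f e == i]].

Definition uniform_pmf (R : realType) (l : nat) (i : 'I_l) : R := l%:R^-1.

(* The product of the uniform distributions over the edges: the law of a
   colouring that picks a uniform colour for each edge independently. *)
Definition colouring_pmf (R : realType) (T : finType) (E : {set {set T}})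
    (l : nat) (f : edge_colouring E l) : R :=
  \prod_(e : {e : {set T} | e \in E}) uniform_pmf R (f e).

Definition colouring_prob (R : realType) (T : finType) (E : {set {set T}})
    (l : nat) (B : {set edge_colouring E l}) : R :=
  \sum_(f in B) colouring_pmf R f.

Definition num_parts (R : realType) (T : finType) (E : {set {set T}}) (C : R) :
    nat :=
  Num.truncn ((edge_connectivity E)%:R / (C * ln (#|T|%:R : R))).

Lemma bigminn_le (I : finType) (P : pred I) (F : I -> nat) d i :
  P i -> (\big[minn/d]_(j | P j) F j <= F i)%N.
Proof.
move=> Pi; rewrite -big_filter.
have: i \in [seq j <- index_enum I | P j] by rewrite mem_filter Pi mem_index_enum.
elim: [seq j <- _ | _] => //= j s IH; rewrite inE big_cons => /orP[/eqP->|/IH h].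
  exact: geq_minl.
exact: leq_trans (geq_minr _ _) h.
Qed.

Lemma bigminn_attained (I : finType) (P : pred I) (F : I -> nat) d i0 :
  P i0 -> (forall i, P i -> F i <= d)%N ->
  exists2 i, P i & (\big[minn/d]_(j | P j) F j = F i)%N.
Proof.
move=> P0 Fd.
have [i Pi im] := arg_minnP F P0.
exists i => //; apply/eqP; rewrite eqn_leq bigminn_le //=.
by elim/big_ind: _ => [|a b ha hb|]; [exact: Fd|rewrite leq_min ha hb|exact: im].
Qed.

Lemma distP (T : finType) (E : {set {set T}}) (x y : T) :
  connect (adj E) x y ->
  has_walk E (dist E x y) x y /\
  (forall k, has_walk E k x y -> dist E x y <= k)%N.
Proof.
move=> cxy.
have short k : has_walk E k x y ->
    exists2 j : 'I_#|T|, has_walk E j x y & (j <= k)%N.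
  move=> /existsP[p /andP[pp /eqP lp]].
  case: (shortenP pp) lp => q qp qu sub lq.
  have qT : (size q < #|T|)%N by rewrite -[(size q).+1]/(size (x :: q)) -(card_uniqP qu) max_card.
  exists (Ordinal qT) => /=.
    by apply/existsP; exists (in_tuple q); rewrite /= qp lq eqxx.
  rewrite -(size_tuple p); apply: uniq_leq_size => //.
  by case/andP: qu.
have [q qp ly] := connectP cxy.
have /short[j wj _] : has_walk E (size q) x y.
  by apply/existsP; exists (in_tuple q); rewrite /= qp -ly eqxx.
split=> [|k /short[i wi /(leq_trans _)-> //]].
  rewrite /dist.
  have [|i wi ->] := @bigminn_attained 'I_#|T| (fun k => has_walk E k x y) (fun k => k) #|T| j wj.
    by move=> i _; exact: ltnW.
  exact: wi.
exact: (@bigminn_le 'I_#|T| (fun k => has_walk E k x y) (fun k => k)).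
Qed.

Lemma min_degreeP (T : finType) (E : {set {set T}}) :
  (0 < #|T|)%N ->
  (exists x, min_degree E = degree E x) /\
  (forall x, min_degree E <= degree E x)%N.
Proof.
move=> /card_gt0P[x0 _]; split=> [|x]; last exact: bigminn_le.
have [|x _ h] := @bigminn_attained T xpredT (degree E) #|E| x0 isT; last by exists x.
by move=> x _; apply: subset_leq_card; apply/subsetP => e; rewrite inE => /andP[].
Qed.

Lemma edge_connectivityP (T : finType) (E : {set {set T}}) :
  (1 < #|T|)%N ->
  (exists S : {set T},
     [/\ S != set0, S != setT & edge_connectivity E = #|edge_cut E S|]) /\
  (forall S : {set T}, S != set0 -> S != setT ->
     edge_connectivity E <= #|edge_cut E S|)%N.
Proof.
move=> T1; split=> [|S S0 ST]; last by apply: bigminn_le; rewrite S0.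
have /card_gt0P[x _] := ltnW T1.
have Px : ([set x] != set0) && ([set x] != setT).
  apply/andP; split; first by apply/set0Pn; exists x; rewrite inE.
  by apply/eqP => /(congr1 (fun A : {set T} => #|A|)); rewrite cards1 cardsT => h; rewrite -h in T1.
have [|S /andP[S0 ST] eS] := @bigminn_attained {set T} (fun S => (S != set0) && (S != setT))
  (fun S => #|edge_cut E S|) #|E| _ Px.
  by move=> S _; apply: subset_leq_card; apply/subsetP => e; rewrite inE => /andP[].
by exists S.
Qed.

Lemma colouring_prob_setT (R : realType) (T : finType) (E : {set {set T}})
    (l : nat) :
  (0 < l)%N -> colouring_prob R [set: edge_colouring E l] = 1.
Proof.
move=> l0; rewrite /colouring_prob /colouring_pmf.
under eq_bigl do rewrite inE.
rewrite -(bigA_distr_bigA (fun (_ : {e | e \in E}) (i : 'I_l) => uniform_pmf R i)) /=.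
rewrite big1 // => e _.
rewrite /uniform_pmf sumr_const card_ord -[LHS]mulr_natr mulVf //.
by rewrite pnatr_eq0 -lt0n.
Qed.

(* Main.v *)
Require Import Defs.
From HB Require Import structures.
From mathcomp Require Import all_boot all_order all_algebra.
From mathcomp Require Import reals sequences exp.
From mathcomp Require Import zify ring lra.

Set Implicit Arguments.
Unset Strict Implicit.
Unset Printing Implicit Defensive.

Import Order.TTheory GRing.Theory Num.Theory.

(* With l parts, each part is a random subgraph keeping every edge with
   probability p = 1/l >= C ln n / lambda.

   Connectivity. Let k(S) be the number of components of the edge set S, and
   a_m the sum of k(S) - 1 over the m-subsets S of E. Every component is left by
   at least lambda edges, so at least lambda k(S) / 2 edges join two different
   components when k(S) > 1, and adding any of them decreases k. Double counting
   the pairs (S, e) gives (m + 1) a_(m+1) <= (|E| - lambda/2 - m) a_m, hence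
   a_m <= (n - 1) 'C(|E| - lambda/2, m), and the expectation of k - 1 in a part
   is at most (n - 1) (1 - p)^(lambda/2).

   Diameter. If 4|B| <= delta and B <= U with |U| <= 2|B|, then at least
   |B| delta / 2 edges join B to the complement of U; a union bound over (B, U)
   shows that no part misses all of these edges, so that in every part the
   closed neighbourhood of such a B has more than 2|B| vertices. All balls of
   radius r > log2 n then have at least delta / 4 vertices, and a shortest path
   of length D contains about D / (2r + 1) vertices with disjoint balls, so
   D delta <= 4 n (2r + 1). *)

(** * Connected components *)

Lemma adj_sym (T : finType) (S : {set {set T}}) : symmetric (adj S).
Proof. by move=> x y; rewrite /adj setUC. Qed.

Lemma connect_adjC (T : finType) (S : {set {set T}}) : connect_sym (adj S).
Proof. exact/sym_connect_sym/adj_sym. Qed.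

Lemma connect_adjS (T : finType) (S S' : {set {set T}}) x y :
  S \subset S' -> connect (adj S) x y -> connect (adj S') x y.
Proof.
move=> sub; apply: connect_sub => {}x {}y xy; apply: connect1.
exact: (subsetP sub).
Qed.

Definition component (T : finType) (S : {set {set T}}) (x : T) : {set T} :=
  [set y | connect (adj S) x y].

Definition components (T : finType) (S : {set {set T}}) : {set {set T}} :=
  [set component S x | x : T].

Lemma eq_component (T : finType) (S : {set {set T}}) x y :
  connect (adj S) x y -> component S x = component S y.
Proof.
move=> cxy; apply/setP => z; rewrite !inE.
exact: (same_connect (@connect_adjC _ S)).
Qed.

(** Writing the coarser partition as an image of the finer one shows that the count cannot grow, and
    that it drops strictly once this map identifies two components. *)
Lemma componentsS (T : finType) (S S' : {set {set T}}) :
  S \subset S' ->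
  components S' =
    (fun B : {set T} => \bigcup_(x in B) component S' x) @: components S.
Proof.
move=> sub; rewrite -imset_comp; apply: eq_imset => x /=.
apply/eqP; rewrite eqEsubset; apply/andP; split.
  by apply: (bigcup_sup x); rewrite ?inE.
apply/bigcupsP => y; rewrite inE => /(connect_adjS sub) cxy.
by rewrite (eq_component cxy).
Qed.

Lemma card_componentsS (T : finType) (S S' : {set {set T}}) :
  S \subset S' -> #|components S'| <= #|components S|.
Proof. by move/componentsS->; apply: leq_imset_card. Qed.

Lemma card_components_add (T : finType) (S : {set {set T}}) x y :
  ~~ connect (adj S) x y -> #|components ([set x; y] |: S)| < #|components S|.
Proof.
move=> ncxy; have sub : S \subset [set x; y] |: S by apply: subsetUr.
rewrite ltn_neqAle card_componentsS // andbT (componentsS sub).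
set f := fun B : {set T} => _.
apply: contra ncxy => /imset_injP finj.
(* On components, [f] is enlargement. If no component were lost, [f] would be injective, yet the
   components of [x] and [y] have the same image. *)
have fE z : f (component S z) = component ([set x; y] |: S) z.
  apply/eqP; rewrite eqEsubset; apply/andP; split.
    apply/bigcupsP => t; rewrite inE => /(connect_adjS sub) czt.
    by rewrite (eq_component czt).
  by apply: (bigcup_sup z); rewrite ?inE.
have : y \in component S x.
  rewrite (finj (component S x) (component S y)) ?imset_f ?inE //.
  by rewrite !fE; apply/eq_component/connect1; rewrite /adj setU11.
by rewrite inE.
Qed.

Lemma card_components_le1 (T : finType) (S : {set {set T}}) :
  #|components S| <= 1 -> graph_connected S.
Proof.
move=> /card_le1_eqP h; apply/forallP => x; apply/forallP => y.
have /setP/(_ y) : component S x = component S y by apply: h; apply: imset_f.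
by rewrite !inE connect0.
Qed.

Lemma card_components_gt0 (T : finType) (S : {set {set T}}) :
  0 < #|T| -> 0 < #|components S|.
Proof.
by case/card_gt0P=> x _; apply/card_gt0P; exists (component S x); apply: imset_f.
Qed.

Definition crossing (T : finType) (E S : {set {set T}}) : {set {set T}} :=
  [set e in E | [exists x, exists y,
    (e == [set x; y]) && ~~ connect (adj S) x y]].

(** Double counting of pairs (component, edge of its cut): each component has at least
    [edge_connectivity E] such edges, only crossing edges occur, and each of them lies in at most
    two of the cuts. *)
Lemma crossing_components (T : finType) (E S : {set {set T}}) :
  1 < #|T| -> 1 < #|components S| ->
  edge_connectivity E * #|components S| <= 2 * #|crossing E S|.
Proof.
move=> T1 k1; have [_ minc] := edge_connectivityP E T1.
have cut B : B \in components S -> edge_connectivity E <= #|edge_cut E B|.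
  case/imsetP=> x _ ->; apply: minc; first by apply/set0Pn; exists x; rewrite inE.
  (* A component equal to the whole vertex set would be the only one. *)
  apply: contraTneq k1 => xT; rewrite -leqNgt.
  apply/card_le1_eqP => _ _ /imsetP[y _ ->] /imsetP[z _ ->].
  have c t : component S x = component S t.
    by apply: eq_component; move/setP/(_ t): xT; rewrite !inE.
  by rewrite -!c.
rewrite mulnC -sum_nat_const.
apply: (@leq_trans (\sum_(B in components S) #|edge_cut E B|)).
  exact: leq_sum.
have -> : \sum_(B in components S) #|edge_cut E B|
     = \sum_(e in E) \sum_(B in components S) (e \in edge_cut E B).
  rewrite exchange_big; apply: eq_bigr => B _ /=.
  rewrite -sum1_card big_mkcond [RHS]big_mkcond; apply: eq_bigr => e _.
  by rewrite inE; case: (e \in E) => //=; case: ifP.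
rewrite mulnC -sum_nat_const big_mkcond [leqRHS]big_mkcond /=.
apply: leq_sum => e _; case: ifP => eE //.
case: ifPn => [|ncr]; last first.
  rewrite big1 // => _ /imsetP[x _ ->]; apply/eqP; rewrite eqb0.
  apply: contra ncr; rewrite !inE eE /=.
  case/exists_inP=> y; rewrite inE => cxy /exists_inP[z]; rewrite !inE => ncxz ez.
  apply/existsP; exists y; apply/existsP; exists z; rewrite ez /=.
  by apply: contra ncxz; apply: connect_trans.
rewrite inE => /andP[_] /existsP[x /existsP[y /andP[/eqP exy _]]].
have -> : \sum_(B in components S) (e \in edge_cut E B)
     = #|[set B in components S | e \in edge_cut E B]|.
  rewrite -sum1_card big_mkcond [RHS]big_mkcond; apply: eq_bigr => B _.
  by rewrite inE; case: (B \in _) => //=; case: ifP.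
apply: (@leq_trans #|[set component S x; component S y]|); last first.
  by rewrite cards2; case: (_ != _).
apply: subset_leq_card; apply/subsetP => B; rewrite inE => /andP[/imsetP[z _ ->]].
rewrite inE => /andP[_ /exists_inP[u]]; rewrite inE => czu /exists_inP[v _ /eqP euv].
have : u \in [set x; y] by rewrite -exy euv !inE eqxx.
by rewrite !inE (eq_component czu) => /orP[] /eqP ->; rewrite eqxx ?orbT.
Qed.

Lemma sum_components_add (T : finType) (E S : {set {set T}}) :
  1 < #|T| -> S \subset E ->
  \sum_(e in E :\: S) (#|components (e |: S)| - 1) <=
  (#|E| - (edge_connectivity E)./2 - #|S|) * (#|components S| - 1).
Proof.
move=> T1 SE; set k := #|components S|.
have [k1|k1] := leqP k 1.
  rewrite big1 // => e _; apply/eqP; rewrite subn_eq0.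
  exact: leq_trans (card_componentsS (subsetUr _ _)) k1.
(* Weakening [k] to [k - 1] makes the guaranteed loss proportional to [k - 1], so that the recursion
   in [m] becomes purely multiplicative. *)
have cross : (edge_connectivity E)./2 * (k - 1) <= #|crossing E S|.
  rewrite -(leq_pmul2l (isT : 0 < 2)).
  apply: leq_trans (crossing_components E T1 k1); rewrite mulnA.
  by apply: leq_mul; [rewrite mul2n halfK leq_subr | rewrite leq_subr].
have sumD : \sum_(e in E :\: S) (#|components (e |: S)| - 1) + #|crossing E S|
    <= #|E :\: S| * (k - 1).
  (* Crossing edges are never in [S], since the ends of an edge of [S] are connected. *)
  have -> : #|crossing E S| = \sum_(e in E :\: S) (e \in crossing E S).
    rewrite -sum1_card big_mkcond [RHS]big_mkcond; apply: eq_bigr => e _.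
    rewrite [e \in E :\: S]inE; case: ifP => [|_]; last by case: ifP.
    rewrite inE => /andP[-> /existsP[x /existsP[y /andP[/eqP -> ncxy]]]].
    rewrite andbT; case: ifP => // /negbFE xyS.
    by rewrite connect1 in ncxy.
  rewrite -big_split -sum_nat_const; apply: leq_sum => e _ /=.
  case: (boolP (e \in crossing E S)) => [|_]; last first.
    by rewrite addn0 leq_sub2r // card_componentsS // subsetUr.
  rewrite inE => /andP[_ /existsP[x /existsP[y /andP[/eqP -> ncxy]]]].
  rewrite [nat_of_bool true]/= subnK ?card_components_gt0 ?(ltnW T1) //.
  by rewrite leq_subRL ?(ltnW k1) // add1n; apply: card_components_add.
rewrite subnAC mulnBl -(cardsDS SE).
have h := leq_trans (leq_add (leqnn _) cross) sumD.
rewrite leq_subRL ?[(_ * (k - 1) + _)%N]addnC //.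
by apply: leq_trans h; apply: leq_addl.
Qed.

(** Each set of size [m.+1] arises as [e |: S] from exactly [m.+1] pairs, one for each choice of [e]
    in it. *)
Lemma sum_card_subset_add (U : finType) (E : {set U}) (h : {set U} -> nat) m :
  \sum_(S : {set U} | (S \subset E) && (#|S| == m)) \sum_(e in E :\: S) h (e |: S)
  = m.+1 * \sum_(S : {set U} | (S \subset E) && (#|S| == m.+1)) h S.
Proof.
rewrite big_distrr /=.
transitivity (\sum_(S : {set U} | (S \subset E) && (#|S| == m.+1)) \sum_(e in S) h S).
  rewrite (exchange_big_dep (mem E)) /=; last by move=> S e _; rewrite inE => /andP[].
  rewrite (exchange_big_dep (mem E)) /=; last by move=> S e /andP[/subsetP SE _] /SE.
  apply: eq_bigr => e eE.
  rewrite [RHS](reindex_onto (fun S => e |: S) (fun S => S :\ e)) /=; last first.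
    by move=> S /andP[_ eS]; rewrite setD1K.
  apply: eq_bigl => S; rewrite subUset sub1set eE setU11 andbT inE eE andbT /=.
  have [eS|eS] := boolP (e \in S).
    rewrite andbF; apply/esym/negbTE; rewrite negb_and; apply/orP; right.
    by apply: contraTneq eS => <-; rewrite !inE eqxx.
  by rewrite setU1K // eqxx !andbT cardsU1 eS.
by apply: eq_bigr => S /andP[_ /eqP Sm]; rewrite sum_nat_const Sm.
Qed.

(** The recursion from [sum_components_add] is the one satisfied by binomial coefficients, (m + 1)
    'C(N, m + 1) = (N - m) 'C(N, m), with N = |E| - lambda/2. *)
Lemma sum_components_draws (T : finType) (E : {set {set T}}) m :
  1 < #|T| ->
  \sum_(S : {set {set T}} | (S \subset E) && (#|S| == m)) (#|components S| - 1)
  <= (#|T| - 1) * 'C(#|E| - (edge_connectivity E)./2, m).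
Proof.
move=> T1; elim: m => [|m IHm].
  rewrite bin0 muln1 (big_pred1 set0) => [|S]; last first.
    by rewrite cards_eq0 /=; case: eqP => [->|_]; rewrite ?sub0set ?andbF.
  by apply: leq_sub2r; apply: leq_imset_card.
rewrite -(leq_pmul2l (ltn0Sn m)) mulnCA mul_bin_left -sum_card_subset_add.
rewrite mulnCA; apply: leq_trans (leq_mul (leqnn _) IHm).
rewrite big_distrr /=; apply: leq_sum => S /andP[SE /eqP <-].
exact: sum_components_add.
Qed.

(** * Balls and neighbourhood expansion *)

Definition nbhd (T : finType) (S : {set {set T}}) (B : {set T}) : {set T} :=
  B :|: [set y | [exists x in B, adj S x y]].

Definition ball (T : finType) (S : {set {set T}}) (j : nat) (x : T) : {set T} :=
  iter j (nbhd S) [set x].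

Lemma ballS (T : finType) (S : {set {set T}}) i j x :
  i <= j -> ball S i x \subset ball S j x.
Proof.
move/subnK <-; elim: (j - i) => //= k /subset_trans; apply.
exact: subsetUl.
Qed.

Lemma ball_step (T : finType) (S : {set {set T}}) j x y z :
  y \in ball S j x -> adj S y z -> z \in ball S j.+1 x.
Proof.
by move=> yB yz; rewrite inE; apply/orP; right; rewrite inE; apply/exists_inP; exists y.
Qed.

Lemma ballSP (T : finType) (S : {set {set T}}) j x z :
  z \in ball S j.+1 x ->
  z \in ball S j x \/ exists2 y, y \in ball S j x & adj S y z.
Proof.
rewrite [ball _ _ _]/= inE => /orP[|]; first by left.
by rewrite inE => /exists_inP[y yB yz]; right; exists y.
Qed.

Lemma ball_trans (T : finType) (S : {set {set T}}) i j x y z :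
  y \in ball S i x -> z \in ball S j y -> z \in ball S (i + j) x.
Proof.
move=> yB; elim: j z => [|j IHj] z; first by rewrite addn0 inE => /eqP ->.
rewrite addnS => /ballSP[/IHj|[w /IHj wB wz]]; last exact: ball_step wz.
exact/subsetP/ballS.
Qed.

Lemma ball_sym (T : finType) (S : {set {set T}}) j x y :
  y \in ball S j x -> x \in ball S j y.
Proof.
elim: j y => [|j IHj] y; first by rewrite !inE eq_sym.
case/ballSP=> [/IHj|[z /IHj xB zy]]; first exact/subsetP/ballS.
rewrite -add1n; apply: ball_trans xB.
by apply: (@ball_step _ _ 0 _ y); rewrite ?inE // adj_sym.
Qed.

Lemma has_walk_ball (T : finType) (S : {set {set T}}) k x y :
  has_walk S k x y -> y \in ball S k x.
Proof.
case/existsP=> -[p /= /eqP <-] /andP[xp /eqP <-] {k y}.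
elim/last_ind: p xp => [|p z IHp]; first by rewrite inE.
rewrite rcons_path last_rcons size_rcons => /andP[/IHp]; exact: ball_step.
Qed.

Lemma ball_has_walk (T : finType) (S : {set {set T}}) j x y :
  y \in ball S j x -> exists2 k, k <= j & has_walk S k x y.
Proof.
elim: j y => [|j IHj] y.
  rewrite inE => /eqP ->; exists 0 => //.
  by apply/existsP; exists [tuple]; rewrite /= eqxx.
case/ballSP=> [/IHj[k kj w]|[z /IHj[k kj /existsP[p /andP[xp /eqP lp]]] zy]].
  by exists k; first exact: leqW.
exists k.+1 => //; apply/existsP; exists [tuple of rcons p y].
by rewrite /= rcons_path xp lp zy last_rcons eqxx.
Qed.

Lemma ball_dist (T : finType) (S : {set {set T}}) x y :
  connect (adj S) x y ->
  forall j, (y \in ball S j x) = (dist S x y <= j).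
Proof.
move=> /distP[w wmin] j; apply/idP/idP => [/ball_has_walk[k kj /wmin]|dj].
  by move/leq_trans; apply.
by apply/(subsetP (ballS S x dj))/has_walk_ball.
Qed.

(** If a level before [y] were empty, the balls around [x] would stop growing there and never reach
    [y]. *)
Lemma ball_level (T : finType) (S : {set {set T}}) x y j :
  connect (adj S) x y -> j < dist S x y ->
  exists2 v, v \in ball S j.+1 x & v \notin ball S j x.
Proof.
move=> cxy jd; apply/subsetPn; apply: contraTN jd => sub.
rewrite -leqNgt -(ball_dist cxy).
have eq_ball : nbhd S (ball S j x) = ball S j x.
  by apply/eqP; rewrite eqEsubset sub subsetUl.
have [//|/ltnW/subnK e] := leqP (dist S x y) j.
  by rewrite ball_dist.
suff -> : ball S j x = ball S (dist S x y) x by rewrite ball_dist.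
rewrite -e; elim: (_ - _) => //= i <-; exact/esym.
Qed.

Lemma dist_card_ball (T : finType) (S : {set {set T}}) (d r : nat) :
  (forall v, d <= 4 * #|ball S r v|) ->
  forall x y, connect (adj S) x y ->
  dist S x y * d <= 4 * #|T| * (2 * r).+1.
Proof.
move=> dr x y cxy; set m := (2 * r).+1.
(* Vertices at distances 0, m, 2m, ..., km from [x] have disjoint balls of radius [r], all inside
   the ball of radius km + r. The spacing 2r + 1 is the least that forces disjointness. *)
have levels k : k * m <= dist S x y -> k.+1 * d <= 4 * #|ball S (k * m + r) x|.
  elim: k => [|k IHk] km; first by rewrite mul1n; apply: dr.
  have km' : k * m + 2 * r < dist S x y.
    by apply: leq_trans km; rewrite (mulSn k) [leqRHS]addnC addnS.
  have [v vB vnB] := ball_level cxy km'.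
  rewrite (mulSn k.+1); apply: leq_trans (leq_add (dr v) (IHk _)) _.
    by apply: leq_trans (ltnW km'); apply: leq_addr.
  have dis : [disjoint ball S r v & ball S (k * m + r) x].
    rewrite -setI_eq0; apply: contraNT vnB => /set0Pn[z /setIP[/ball_sym zv zx]].
    by rewrite mul2n -addnn addnA; apply: ball_trans zx zv.
  have mE : (k * m + 2 * r).+1 = k.+1 * m by rewrite (mulSn k) [RHS]addnC addnS.
  rewrite mE in vB.
  rewrite -mulnDr leq_mul2l; apply/orP; right.
  rewrite -cardsUI (disjoint_setI0 dis) cards0 addn0.
  apply/subset_leq_card; rewrite subUset ballS ?andbT.
    by apply/subsetP => z; apply: ball_trans vB.
  by rewrite leq_add2r leq_mul2r leqnSn orbT.
have Dm : dist S x y <= (dist S x y %/ m).+1 * m by rewrite ltnW // ltn_ceil.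
apply: leq_trans (_ : (dist S x y %/ m).+1 * m * d <= _).
  by rewrite leq_mul2r Dm orbT.
rewrite mulnAC leq_mul2r; apply/orP; right.
apply: leq_trans (levels _ (leq_divM _ _)) _.
by rewrite leq_mul2l max_card.
Qed.

Definition expanding (T : finType) (S : {set {set T}}) (d : nat) : bool :=
  [forall B : {set T}, (B != set0) && (4 * #|B| <= d) ==> (2 * #|B| < #|nbhd S B|)].

Lemma expanding_card_ball (T : finType) (S : {set {set T}}) d r x :
  expanding S d -> #|T| < 2 ^ r -> d <= 4 * #|ball S r x|.
Proof.
move=> /forallP exS Tr.
(* The ball doubles at each step until it passes d/4, and stays above that threshold afterwards.
   Doubling [r] times is impossible, as 2^r exceeds the number of vertices. *)
suff [/leq_trans/(_ (max_card _))|//] : 2 ^ r <= #|ball S r x| \/ d <= 4 * #|ball S r x|.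
  by rewrite leqNgt Tr.
elim: {Tr} r => [|r [IHr|IHr]]; first by left; rewrite cards1.
  have [dB|dB] := leqP d (4 * #|ball S r x|).
    by right; apply: leq_trans dB _; rewrite leq_mul2l subset_leq_card ?ballS.
  left; have /implyP/(_ _)/ltnW := exS (ball S r x).
  rewrite (ltnW dB) andbT expnS => h; apply: leq_trans (h _).
    by rewrite leq_mul2l IHr.
  by rewrite -card_gt0 (leq_trans _ IHr) ?expn_gt0.
by right; apply: leq_trans IHr _; rewrite leq_mul2l subset_leq_card ?ballS.
Qed.

Lemma diameter_expanding (T : finType) (S : {set {set T}}) d r :
  graph_connected S -> expanding S d -> #|T| < 2 ^ r ->
  graph_diameter S * d <= 4 * #|T| * (2 * r).+1.
Proof.
move=> /forallP cS exS Tr; case: d => [|d] in exS *; first by rewrite muln0.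
rewrite -leq_divRL //; apply/bigmax_leqP => x _; apply/bigmax_leqP => y _.
rewrite leq_divRL //; apply: dist_card_ball => [v|].
  exact: expanding_card_ball.
exact: (forallP (cS x)).
Qed.

(** * Edges leaving a vertex set, and failure of expansion *)

Definition edges_between (T : finType) (E : {set {set T}}) (B U : {set T}) :
    {set {set T}} :=
  [set e in E | [exists x in B, exists y in U, e == [set x; y]]].

(** In a simple graph an edge at [x] is determined by its other end, which is either one of the
    other |U| - 1 vertices of [U] or outside [U]. *)
Lemma degree_le_between (T : finType) (E : {set {set T}}) (U : {set T}) x :
  simple_graph E -> x \in U ->
  degree E x <= #|U| - 1 + #|edges_between E [set x] (~: U)|.
Proof.
move=> /forall_inP simpE xU.
have -> : #|U| - 1 = #|U :\ x| by rewrite (cardsD1 x U) xU add1n subn1.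
apply: (@leq_trans (#|[set [set x; y] | y in U :\ x]|
                    + #|edges_between E [set x] (~: U)|)); last first.
  by rewrite leq_add2r leq_imset_card.
rewrite -cardsUI (leq_trans _ (leq_addr _ _)) // subset_leq_card //.
apply/subsetP => e; rewrite !inE => /andP[eE xe].
have /cards1P[y ey] : #|e :\ x| == 1.
  by have := cardsD1 x e; rewrite xe (eqP (simpE _ eE)) add1n => -[<-].
have yx : y != x by have := set11 y; rewrite -ey !inE => /andP[].
have e2 : e = [set x; y] by rewrite -(setD1K xe) ey.
have [yU|yU] := boolP (y \in U).
  by apply/orP; left; apply/imsetP; exists y; rewrite ?inE ?yx.
apply/orP; right; rewrite eE /=; apply/exists_inP; exists x; first by rewrite inE.
by apply/exists_inP; exists y; rewrite ?inE // e2.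
Qed.

Lemma min_degree_lt (T : finType) (E : {set {set T}}) :
  simple_graph E -> 0 < #|T| -> min_degree E < #|T|.
Proof.
move=> simpE T0; have [_ mind] := min_degreeP E T0.
have /card_gt0P[x _] := T0.
have := leq_trans (mind x) (degree_le_between simpE (in_setT x)).
rewrite (_ : edges_between _ _ _ = set0) ?cards0 ?addn0 ?cardsT => [h|].
  by rewrite -(subnK T0) addn1 ltnS.
apply/setP => e; rewrite !inE; apply/negbTE; rewrite negb_and orbC.
apply/orP; left; apply/exists_inPn => y _; apply/exists_inPn => z.
by rewrite !inE.
Qed.

(** Summing the previous bound over [B] counts no edge twice: an edge leaving [U] has only one end
    in [B]. *)
Lemma card_edges_between (T : finType) (E : {set {set T}}) (B U : {set T}) :
  simple_graph E -> B \subset U ->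
  #|B| * (min_degree E - (#|U| - 1)) <= #|edges_between E B (~: U)|.
Proof.
move=> simpE BU.
case: (posnP #|T|) => [T0|T0].
  by rewrite (_ : #|B| = 0) //; apply/eqP; rewrite -leqn0 -T0 max_card.
have [_ mind] := min_degreeP E T0.
apply: (@leq_trans (\sum_(x in B) #|edges_between E [set x] (~: U)|)).
  rewrite -sum_nat_const; apply: leq_sum => x xB; rewrite leq_subLR.
  exact: leq_trans (mind x) (degree_le_between simpE (subsetP BU x xB)).
have -> : \sum_(x in B) #|edges_between E [set x] (~: U)| =
    \sum_(x in B) \sum_(e in edges_between E B (~: U))
       (e \in edges_between E [set x] (~: U)).
  apply: eq_bigr => x xB.
  rewrite -sum1_card big_mkcond [RHS]big_mkcond; apply: eq_bigr => e _.
  case: ifP => [|_]; last by case: ifP.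
  rewrite !inE => /andP[-> /exists_inP[z]]; rewrite inE => /eqP -> h.
  by rewrite [X in if X then _ else _](_ : _ = true) //; apply/exists_inP; exists x.
rewrite exchange_big /= -sum1_card; apply: leq_sum => e _.
have -> : \sum_(x in B) (e \in edges_between E [set x] (~: U))
     = #|[set x in B | e \in edges_between E [set x] (~: U)]|.
  rewrite -sum1_card big_mkcond [RHS]big_mkcond; apply: eq_bigr => x _.
  by rewrite inE; case: (x \in _) => //=; case: ifP.
apply/card_le1_eqP => x y; rewrite !inE => /and3P[xB _ /exists_inP[x']].
rewrite inE => /eqP -> {x'} /exists_inP[u]; rewrite inE => uU /eqP ->.
move=> /and3P[yB _ /exists_inP[y']].
rewrite inE => /eqP -> {y'} /exists_inP[v]; rewrite inE => vU /eqP /setP/(_ x).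
rewrite !inE eqxx /= => /esym/orP[/eqP //|/eqP xv].
by rewrite -xv (subsetP BU x xB) in vU.
Qed.

(** The witness [U] is the neighbourhood of [B] in [S]. Forgetting this leaves an edge set that
    depends on [B] and [U] only, so a union bound can fix it before the random colouring. *)
Lemma not_expandingP (T : finType) (E S : {set {set T}}) :
  simple_graph E -> ~~ expanding S (min_degree E) ->
  exists B U : {set T},
    [/\ B != set0, B \subset U, #|U| <= 2 * #|B|,
        #|B| * min_degree E <= 2 * #|edges_between E B (~: U)| &
        [disjoint S & edges_between E B (~: U)]].
Proof.
move=> simpE /forallPn[B]; rewrite negb_imply -leqNgt => /andP[/andP[B0 Bd] BU].
exists B, (nbhd S B); split=> //; first exact: subsetUl.
  have := card_edges_between simpE (subsetUl B _ : B \subset nbhd S B).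
  rewrite -(leq_pmul2l (isT : 0 < 2)); apply: leq_trans.
  (* Here |U| <= 2|B| <= d/2, so at least half of the degree of each vertex of [B] leaves [U]. *)
  rewrite mulnCA leq_mul2l; apply/orP; right.
  lia.
rewrite -setI_eq0; apply/eqP/setP => e; rewrite !inE; apply/negbTE.
apply/negP => /and3P[eS _ /exists_inP[x xB /exists_inP[y]]].
rewrite !inE negb_or => /andP[_ /exists_inPn/(_ x xB)] h /eqP exy.
by rewrite /adj -exy eS in h.
Qed.

Lemma edge_connectivity_le_min_degree (T : finType) (E : {set {set T}}) :
  1 < #|T| -> edge_connectivity E <= min_degree E.
Proof.
move=> T1; have [[x ->] _] := min_degreeP E (ltnW T1).
have [_ minc] := edge_connectivityP E T1.
apply: leq_trans (minc [set x] _ _) _.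
- by apply/set0Pn; exists x; rewrite inE.
- by apply: contraTneq T1 => xT; rewrite -cardsT -xT cards1.
apply/subset_leq_card/subsetP => e; rewrite !inE => /andP[-> /exists_inP[y]].
by rewrite inE => /eqP -> /exists_inP[z _ /eqP ->]; rewrite !inE eqxx.
Qed.

Local Open Scope ring_scope.

(** * Random parts *)

Lemma mem_part (T : finType) (E : {set {set T}}) l (f : edge_colouring E l) i
    (e : {e : {set T} | e \in E}) :
  (val e \in part f i) = (f e == i).
Proof. by rewrite (mem_imset _ _ val_inj) inE. Qed.

Lemma part_sub (T : finType) (E : {set {set T}}) l (f : edge_colouring E l) i :
  part f i \subset E.
Proof. by apply/subsetP => _ /imsetP[e _ ->]; apply: (valP e). Qed.

Lemma colouring_pmf_ge0 (R : realType) (T : finType) (E : {set {set T}}) l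
    (f : edge_colouring E l) :
  0 <= colouring_pmf R f.
Proof. by apply: prodr_ge0 => e _; rewrite /uniform_pmf invr_ge0 ler0n. Qed.

Lemma colouring_prob_setC (R : realType) (T : finType) (E : {set {set T}}) l
    (B : {set edge_colouring E l}) :
  (0 < l)%N -> colouring_prob R B = 1 - colouring_prob R (~: B).
Proof.
move=> l0; rewrite -(colouring_prob_setT R E l0) {2}/colouring_prob.
rewrite (bigID (mem B)) /= [X in _ = X + _ - _](_ : _ = colouring_prob R B); last first.
  by apply: eq_bigl => f; rewrite inE.
rewrite [X in _ = _ + X - _](_ : _ = colouring_prob R (~: B)) ?addrK //.
by apply: eq_bigl => f; rewrite !inE.
Qed.

Lemma colouring_prob_union (R : realType) (T : finType) (E : {set {set T}}) l
    (I : finType) (P : pred I) (A : I -> {set edge_colouring E l})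
    (B : {set edge_colouring E l}) :
  (forall f, f \in B -> exists2 i, P i & f \in A i) ->
  colouring_prob R B <= \sum_(i | P i) colouring_prob R (A i).
Proof.
move=> cover; rewrite /colouring_prob.
under [leRHS]eq_bigr do rewrite big_mkcond /=.
rewrite exchange_big big_mkcond /=; apply: ler_sum => f _.
have ge0 i : 0 <= (if f \in A i then colouring_pmf R f else 0).
  by case: ifP => // _; apply: colouring_pmf_ge0.
case: ifP => [/cover[i Pi fA]|_]; last by apply: sumr_ge0.
by rewrite (bigD1 i Pi) /= fA lerDl sumr_ge0.
Qed.

(** By independence, an event restricting the colour of each edge separately has product
    probability. Avoiding an edge set and being equal to one are both of this form. *)
Lemma colouring_prob_family (R : realType) (T : finType) (E : {set {set T}}) l
    (Q : {set T} -> pred 'I_l) :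
  colouring_prob R
    [set f : edge_colouring E l | [forall e, Q (val e) (f e)]] =
  \prod_(e in E) (#|Q e|%:R / l%:R).
Proof.
rewrite big_sub.
transitivity (\prod_(e : {e | e \in E}) \sum_(i | Q (val e) i) uniform_pmf R i).
  rewrite bigA_distr_big_dep; apply: eq_bigl => f.
  by rewrite inE; apply/forallP/familyP.
by apply: eq_bigr => e _; rewrite sumr_const -[LHS]mulr_natl.
Qed.

Lemma prob_part_avoid (R : realType) (T : finType) (E X : {set {set T}}) l
    (i : 'I_l) :
  X \subset E ->
  colouring_prob R [set f : edge_colouring E l | [disjoint part f i & X]] =
  (1 - l%:R^-1) ^+ #|X|.
Proof.
move=> XE.
have l0 : l%:R != 0 :> R by rewrite pnatr_eq0; case: l i => // -[].
have -> : [set f : edge_colouring E l | [disjoint part f i & X]]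
  = [set f : edge_colouring E l | [forall e, (val e \in X) ==> (f e != i)]].
  apply/setP => f; rewrite !inE -setI_eq0; apply/eqP/forallP => [/setP dis e|h].
    apply/implyP => eX; have := dis (val e).
    by rewrite !inE eX andbT mem_part => ->.
  apply/setP => e; rewrite !inE; apply/negbTE/negP => /andP[ef eX].
  have eE := subsetP XE e eX.
  by have /implyP/(_ eX) := h (Sub e eE); rewrite -mem_part ef.
rewrite (@colouring_prob_family R T E l (fun e j => (e \in X) ==> (j != i))).
rewrite (bigID (mem X)) /= [X in _ * X]big1 ?mulr1; last first.
  move=> e /andP[_ /negbTE ->] /=.
  by rewrite (eq_card (_ : _ =i 'I_l)) // card_ord divff.
rewrite -prodr_const; apply: eq_big => [e|e /andP[_ ->] /=].
  by rewrite andbC; case: (boolP (e \in X)) => // /(subsetP XE) ->.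
rewrite (eq_card (_ : _ =i predC1 i)) // cardC1 card_ord -subn1 natrB.
  by rewrite mulrBl divff // mul1r.
by case: l i {l0} => // -[].
Qed.

Lemma prob_part_eq (R : realType) (T : finType) (E S : {set {set T}}) l
    (i : 'I_l) :
  S \subset E ->
  colouring_prob R [set f : edge_colouring E l | part f i == S] =
  l%:R^-1 ^+ #|S| * (1 - l%:R^-1) ^+ (#|E| - #|S|).
Proof.
move=> SE.
have l0 : l%:R != 0 :> R by rewrite pnatr_eq0; case: l i => // -[].
have -> : [set f : edge_colouring E l | part f i == S]
  = [set f : edge_colouring E l | [forall e, (val e \in S) == (f e == i)]].
  apply/setP => f; rewrite !inE; apply/eqP/forallP => [<- e|h].
    by rewrite mem_part.
  apply/setP => e; case: (boolP (e \in E)) => [eE|eE].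
    by have /eqP := h (Sub e eE); rewrite -mem_part.
  by rewrite (contraNF (subsetP (part_sub f i) e)) // (contraNF (subsetP SE e)).
rewrite (@colouring_prob_family R T E l (fun e j => (e \in S) == (j == i))).
rewrite (bigID (mem S)) /= -cardsDS // -!prodr_const; congr (_ * _).
  apply: eq_big => [e|e /andP[_ ->] /=].
    by rewrite andbC; case: (boolP (e \in S)) => // /(subsetP SE) ->.
  by rewrite (eq_card (_ : _ =i pred1 i)) ?card1 ?mul1r.
apply: eq_big => [e|e /andP[_ /negbTE ->] /=]; first by rewrite inE andbC.
rewrite (eq_card (_ : _ =i predC1 i)) => [|j]; last first.
  by rewrite !inE; case: (j == i).
rewrite cardC1 card_ord -subn1 natrB; first by rewrite mulrBl divff // mul1r.
by case: l i {l0} => // -[].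
Qed.

(** Both sides are the probability that a random subset of M elements, each kept with probability p,
    misses L given ones. Algebraically, (1 - p)^L factors out of the expansion of ((1 - p) + p)^(M -
    L). *)
Lemma binomial_thinning_sum (R : realType) (p : R) (M L : nat) :
  (L <= M)%N ->
  \sum_(m < M.+1) ('C(M - L, m))%:R * (p ^+ m * (1 - p) ^+ (M - m))
  = (1 - p) ^+ L.
Proof.
move=> LM.
have Mw : ((M - L).+1 <= M.+1)%N by rewrite ltnS leq_subr.
pose F m := ('C(M - L, m))%:R * (p ^+ m * (1 - p) ^+ (M - m)) : R.
rewrite -(big_mkord xpredT F) (big_cat_nat (n := (M - L).+1)) //= .
rewrite [X in _ + X]big_nat_cond [X in _ + X]big1 ?addr0; last first.
  by move=> m /andP[/andP[Lm _] _]; rewrite /F bin_small ?mul0r.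
rewrite big_mkord.
have -> : (1 - p) ^+ L = (1 - p) ^+ L * ((1 - p) + p) ^+ (M - L).
  by rewrite subrK expr1n mulr1.
rewrite (exprDn (1 - p) p) big_distrr /=; apply: eq_bigr => m _; rewrite /F.
have -> : (M - m = L + (M - L - m))%N by have := ltn_ord m; lia.
rewrite exprD -mulr_natl /=; ring.
Qed.

Lemma prob_part_disconnected (R : realType) (T : finType)
    (E : {set {set T}}) l (i : 'I_l) :
  (1 < #|T|)%N ->
  colouring_prob R
    [set f : edge_colouring E l | ~~ graph_connected (part f i)] <=
  #|T|%:R * (1 - l%:R^-1) ^+ (edge_connectivity E)./2.
Proof.
move=> T1; set p : R := l%:R^-1; set L := (edge_connectivity E)./2.
have l1 : (1 <= l)%N by case: l i {p} => // -[].
have p0 : 0 <= p by rewrite invr_ge0 ler0n.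
have q0 : 0 <= 1 - p by rewrite subr_ge0 invf_le1 ?ler1n // ltr0n.
(* This makes the subtraction in 'C(|E| - L, m) a genuine one. *)
have LM : (L <= #|E|)%N.
  have [[S [_ _ eS]] _] := edge_connectivityP E T1.
  rewrite /L eS; apply: leq_trans (leq_addl (odd #|edge_cut E S|) _) _.
  rewrite -uphalf_half leq_uphalf_double; apply: leq_trans (_ : #|E| <= _)%N.
    by apply/subset_leq_card/subsetP => e; rewrite inE => /andP[].
  by rewrite -addnn leq_addr.
pose w (S : {set {set T}}) := p ^+ #|S| * (1 - p) ^+ (#|E| - #|S|).
have w0 S : 0 <= w S by rewrite mulr_ge0 ?exprn_ge0.
(* Markov's inequality: a disconnected part has at least two components, so its probability is
   bounded by the expectation of the number of components minus one. *)
have le1 : colouring_prob R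
    [set f : edge_colouring E l | ~~ graph_connected (part f i)] <=
    \sum_(S : {set {set T}} | S \subset E) w S * (#|components S| - 1)%:R.
  apply: le_trans (_ : \sum_(S : {set {set T}} | (S \subset E) &&
      ~~ graph_connected S) w S <= _).
    apply: le_trans (colouring_prob_union (I := {set {set T}})
      (P := fun S => (S \subset E) && ~~ graph_connected S)
      (A := fun S => [set f | part f i == S]) _ _) _.
      move=> f; rewrite inE => nc; exists (part f i); last by rewrite inE.
      by rewrite part_sub.
    by apply: ler_sum => S /andP[SE _]; rewrite prob_part_eq.
  rewrite big_mkcondr /=; apply: ler_sum => S SE.
  case: ifPn => [nc|_]; last by rewrite mulr_ge0 ?ler0n.
  rewrite ler_peMr // ler1n subn_gt0.
  by apply: contraNT nc; rewrite -leqNgt; apply: card_components_le1.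
apply: (le_trans le1).
(* Subsets are grouped by size, since [w] depends on the size alone. [inord] is faithful because
   subsets of [E] have at most |E| elements. *)
rewrite (partition_big (fun S : {set {set T}} => inord #|S| : 'I_#|E|.+1) xpredT) //=.
apply: le_trans (_ : \sum_(m < #|E|.+1) (#|T| - 1)%:R *
   (('C(#|E| - L, m))%:R * (p ^+ m * (1 - p) ^+ (#|E| - m))) <= _); last first.
  rewrite -big_distrr /= binomial_thinning_sum //.
  by rewrite ler_wpM2r ?exprn_ge0 // ler_nat leq_subr.
apply: ler_sum => m _.
have sizeE (S : {set {set T}}) : (S \subset E) && (inord #|S| == m) = (S \subset E) && (#|S| == m).
  have [SE|//] := boolP (S \subset E).
  by rewrite -val_eqE /= inordK // ltnS subset_leq_card.
rewrite (eq_bigl _ _ sizeE).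
rewrite (eq_bigr (fun S => (p ^+ m * (1 - p) ^+ (#|E| - m)) *
    (#|components S| - 1)%:R)); last by move=> S /andP[_ /eqP Sm]; rewrite /w Sm.
rewrite -big_distrr /= mulrA [leRHS]mulrC ler_wpM2l //.
  by rewrite mulr_ge0 ?exprn_ge0.
by rewrite -natrM -natr_sum ler_nat sum_components_draws.
Qed.

(** Padding with a repeated element codes every nonempty set of size at most [k] by a [k]-tuple, so
    there are at most n^k such sets. *)
Lemma set_tuple_cover (T : finType) (A : {set T}) k :
  A != set0 -> (#|A| <= k)%N -> exists t : k.-tuple T, A = [set x in t].
Proof.
case/set0Pn=> x xA Ak.
have st : size (enum A ++ nseq (k - #|A|) x) == k.
  by rewrite size_cat size_nseq -cardE subnKC.
exists (Tuple st); apply/setP => y; rewrite inE mem_cat mem_enum.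
by rewrite mem_nseq; case: eqP => [->|]; rewrite ?xA ?andbF ?orbF.
Qed.

(** For |B| = b there are at most n^(3b) coded pairs (B, U), each failing with probability at most
    t^b. Since n^3 t <= 1, each of the n values of b contributes at most n^3 t. *)
Lemma prob_part_not_expanding (R : realType) (T : finType)
    (E : {set {set T}}) l (i : 'I_l) (t : R) :
  simple_graph E ->
  0 <= t -> #|T|%:R ^+ 3 * t <= 1 ->
  (forall b k, (b * min_degree E <= 2 * k)%N ->
     (1 - l%:R^-1) ^+ k <= t ^+ b) ->
  colouring_prob R
    [set f : edge_colouring E l | ~~ expanding (part f i) (min_degree E)] <=
  #|T|%:R ^+ 4 * t.
Proof.
move=> simpE t0 t1 tb; set n := #|T|; set d := min_degree E.
pose X b (st : b.-tuple T * (2 * b).-tuple T) :=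
  edges_between E [set x in st.1] (~: [set x in st.2]).
(* Tuples with repetitions or unrelated entries may code pairs with few edges between them; [ok]
   keeps those for which the hypothesis on [t] applies. *)
pose ok b st := (b * d <= 2 * #|X b st|)%N.
pose A (b : 'I_n.+1) := [set f : edge_colouring E l |
  [exists st, ok b st && [disjoint part f i & X b st]]].
have XE b st : X b st \subset E by apply/subsetP => e; rewrite inE => /andP[].
have PA b : colouring_prob R (A b) <= (n%:R ^+ 3 * t) ^+ b.
  apply: le_trans (colouring_prob_union (P := @ok b)
    (A := fun st => [set f : edge_colouring E l | [disjoint part f i & X b st]]) _ _) _.
    by move=> f; rewrite inE => /existsP[st /andP[okst dis]]; exists st; rewrite ?inE.
  apply: le_trans (_ : \sum_(st : b.-tuple T * (2 * b).-tuple T) t ^+ b <= _).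
    rewrite big_mkcond /=; apply: ler_sum => st _; case: ifPn => [okst|_].
      by rewrite prob_part_avoid // tb.
    exact: exprn_ge0.
  rewrite sumr_const card_prod !card_tuple -expnD -[leLHS]mulr_natl natrX.
  by rewrite exprMn -exprM (_ : (b + 2 * b = 3 * b)%N) // mulSn.
apply: le_trans (colouring_prob_union (P := fun b : 'I_n.+1 => (0 < b)%N) (A := A) _ _) _.
  move=> f; rewrite inE => /(not_expandingP simpE)[B [U [B0 BU UB dB dis]]].
  have Bn : (#|B| < n.+1)%N by rewrite ltnS max_card.
  have U0 : U != set0 by apply: contraNneq B0 => U0; rewrite -subset0 -U0.
  have [s eB] := set_tuple_cover B0 (leqnn _).
  have [s' eU] := set_tuple_cover U0 UB.
  exists (Ordinal Bn) => /=; first by rewrite card_gt0.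
  rewrite inE; apply/existsP; exists (s, s') => /=.
  by rewrite /ok /X /= -eB -eU dB.
apply: le_trans (_ : \sum_(b < n.+1 | (0 < b)%N) n%:R ^+ 3 * t <= _).
  apply: ler_sum => b b0; apply: le_trans (PA b) _.
  rewrite -[leRHS]expr1; apply: ler_wiXn2l => //.
  by rewrite mulr_ge0 ?exprn_ge0.
rewrite -(big_mkord (fun b => 0 < b)%N (fun _ => n%:R ^+ 3 * t)).
rewrite big_mkcond big_nat_recl //= add0r sumr_const_nat subn0.
by rewrite -[leLHS]mulr_natl exprS mulrA.
Qed.

(** * Logarithmic estimates and the diameter bound *)

Lemma ln_nat_ge_half (R : realType) n : (2 <= n)%N -> 2^-1 <= ln (n%:R : R).
Proof.
move=> n2; have n0 : (0 : R) < n%:R by rewrite ltr0n; lia.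
rewrite -ler_expR lnK //; apply: le_trans (_ : 2%:R <= _); last by rewrite ler_nat.
(* From exp(-1/2) >= 1 - 1/2 follows exp(1/2) <= 2. *)
have := expR_ge1Dx (- 2^-1 : R); rewrite expRN.
have e0 := expR_gt0 (2^-1 : R).
rewrite -(ler_pM2r e0) mulVf ?gt_eqF //; lra.
Qed.

Lemma exprn_1B_le_expR (R : realType) (y : R) k :
  y <= 1 -> (1 - y) ^+ k <= expR (- (k%:R * y)).
Proof.
move=> y1; rewrite -mulrN expRM_natl lerXn2r ?nnegrE ?expR_ge0 ?subr_ge0 //.
exact: expR_ge1Dx.
Qed.

Lemma trunc_log2_le_ln (R : realType) n :
  (2 <= n)%N -> (trunc_log 2 n)%:R <= 2 * ln (n%:R : R).
Proof.
move=> n2; have n0 : (0 : R) < n%:R by rewrite ltr0n; lia.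
have /(ler_wpM2l (ler0n R (trunc_log 2 n))) := ln_nat_ge_half R (leqnn 2).
have : ln ((2 ^ trunc_log 2 n)%:R : R) <= ln (n%:R : R).
  rewrite ler_ln ?posrE // ?ltr0n ?expn_gt0 // ler_nat trunc_logP //.
  exact: ltnW.
rewrite natrX lnXn ?ltr0n // -mulr_natl; lra.
Qed.

Lemma diameter_le_ln (R : realType) (T : finType) (S : {set {set T}}) d :
  (2 <= #|T|)%N -> (0 < d)%N -> graph_connected S -> expanding S d ->
  (graph_diameter S)%:R <= 40 * (#|T|%:R * ln (#|T|%:R : R) / d%:R).
Proof.
move=> T2 d0 cS exS; set n := #|T| in T2 *; set x := ln _.
have h := diameter_expanding cS exS (trunc_log_ltn n (leqnn 2)).
rewrite !mulrA ler_pdivlMr ?ltr0n // -(natrM R (graph_diameter S)).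
apply: le_trans (_ : (4 * n * (2 * (trunc_log 2 n).+1).+1)%:R <= _).
  by rewrite ler_nat.
have x2 : 2^-1 <= x := ln_nat_ge_half R T2.
have lx : (trunc_log 2 n)%:R <= 2 * x := trunc_log2_le_ln R T2.
rewrite (_ : (2 * _).+1 = 2 * trunc_log 2 n + 3)%N; last by lia.
rewrite !natrM natrD natrM mulrAC.
have n0 : (0 : R) <= n%:R := ler0n _ _.
(* The two terms are at most 4x and 6x, the latter because x >= 1/2. With the factor 4 this yields
   the constant 40. *)
have : 2 * (trunc_log 2 n)%:R + 3 <= 10 * x by lra.
move/(ler_wpM2l n0); lra.
Qed.

Theorem theorem2 (R : realType) :
  exists C0 c A : R,
    [/\ 0 < C0, 0 < c & 0 < A] /\
    forall (T : finType) (E : {set {set T}}) (C : R),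
      simple_graph E ->
      graph_connected E ->
      (2 <= #|T|)%N ->
      C0 <= C ->
      (1 <= num_parts E C)%N ->
      1 - #|T|%:R `^ (- (c * C)) <=
      colouring_prob R
        [set f : edge_colouring E (num_parts E C) |
          [forall i : 'I_(num_parts E C),
            [&& part f i \subset E,
                graph_connected (part f i) &
                (graph_diameter (part f i))%:R <=
                  A * (C * #|T|%:R * ln (#|T|%:R : R) / (min_degree E)%:R)]]].
Proof.
(* With x = ln n and y = C x, at most n^2 bad events of probability at most exp(4x - y/3) remain.
   Their total exp(6x - y/3) is at most exp(-y/6) exactly when y >= 36x. *)
exists 36, 6^-1, 40; split; first by split; lra.
move=> T E C simpE _ T2 C36 l1.
set l := num_parts E C in l1 *; set n := #|T| in T2 *; set x := ln _.
set G := [set f | _].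
pose lam := edge_connectivity E; pose d := min_degree E.
have x2 : 2^-1 <= x := ln_nat_ge_half R T2.
have n0 : (0 : R) < n%:R by rewrite ltr0n; lia.
have nE : n%:R = expR x by rewrite lnK.
pose y := C * x.
have xy : 36 * x <= y by rewrite ler_wpM2r //; lra.
have y0 : 0 < y by lra.
have lr0 : (0 : R) < l%:R by rewrite ltr0n.
have ly : l%:R * y <= lam%:R.
  rewrite -ler_pdivlMr // -truncn_ge_nat // divr_ge0 ?ler0n //; exact: ltW.
have lamd : (lam <= d)%N := edge_connectivity_le_min_degree E T2.
have dn : (d < n)%N by apply: min_degree_lt => //; lia.
have l1r : (1 : R) <= l%:R by rewrite ler1n.
have lley : (l%:R : R) <= l%:R * y by rewrite ler_peMr ?ler0n //; lra.
have lam2 : (2 <= lam)%N.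
  by rewrite -(ler_nat R); have := ler_wpM2r (ltW y0) l1r; lra.
(* The chain is l <= l y <= lambda <= d < n, using y >= 18. *)
have len : (l <= n)%N.
  apply: leq_trans (ltnW dn); apply: leq_trans lamd.
  by rewrite -(ler_nat R); apply: le_trans lley ly.
have linv1 : l%:R^-1 <= 1 :> R by rewrite invf_le1.
have powE k (z : R) : l%:R * z <= k%:R -> (1 - l%:R^-1) ^+ k <= expR (- z).
  move=> lz; apply: le_trans (exprn_1B_le_expR k linv1) _.
  by rewrite ler_expR lerN2 ler_pdivlMr // mulrC.
have conn i : colouring_prob R
    [set f : edge_colouring E l | ~~ graph_connected (part f i)]
    <= expR (4 * x - y / 3).
  apply: le_trans (prob_part_disconnected R E i T2) _.
  apply: le_trans (_ : expR x * expR (- (y / 3)) <= _).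
    rewrite -nE ler_wpM2l ?ler0n // powE //.
    (* Rounding lambda/2 down still leaves lambda/3 once lambda >= 2; hence y/3 in the exponent. *)
    have : (lam <= 3 * lam./2)%N by lia.
    rewrite -(ler_nat R) natrM; lra.
  by rewrite -expRD ler_expR; lra.
have grow i : colouring_prob R
    [set f : edge_colouring E l | ~~ expanding (part f i) d]
    <= expR (4 * x - y / 3).
  (* The choice t = exp(-y/2) fits: l y <= lambda <= d and b d <= 2k give l (b y/2) <= k. *)
  apply: le_trans (@prob_part_not_expanding R T E l i (expR (- (y / 2))) _ _ _ _) _.
  - by [].
  - exact: expR_ge0.
  - by rewrite nE -expRM_natl -expRD expR_le1; lra.
  - move=> b k; rewrite -(ler_nat R) !natrM -expRM_natl mulrN => bd.
    apply: powE; rewrite mulrCA.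
    have : b%:R * (l%:R * y) <= b%:R * d%:R :> R.
      by rewrite ler_wpM2l ?ler0n // (le_trans ly) // ler_nat.
    lra.
  - by rewrite nE -expRM_natl -expRD ler_expR; lra.
rewrite colouring_prob_setC // lerB //.
pose A (ib : 'I_l * bool) : {set edge_colouring E l} :=
  if ib.2 then [set f | ~~ graph_connected (part f ib.1)]
  else [set f | ~~ expanding (part f ib.1) d].
apply: le_trans (colouring_prob_union (P := xpredT) (A := A) _ _) _.
  move=> f; rewrite !inE => /forallPn[i bad].
  have [cS|cS] := boolP (graph_connected (part f i)); last first.
    by exists (i, true); rewrite /A ?inE.
  have [exS|exS] := boolP (expanding (part f i) d); last first.
    by exists (i, false); rewrite /A ?inE.
  case/negP: bad; rewrite part_sub cS /=.
  have d0 : (0 < d)%N by lia.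
  (* This bound lacks the factor C of the claim, which only helps since C >= 1. *)
  apply: le_trans (diameter_le_ln R T2 d0 cS exS) _.
  have C1 : 1 <= C by lra.
  have x0 : 0 <= x by lra.
  by rewrite ler_wpM2l // -!mulrA ler_peMl // !mulr_ge0 ?invr_ge0.
apply: le_trans (_ : \sum_(ib : 'I_l * bool) expR (4 * x - y / 3) <= _).
  by apply: ler_sum => -[i []] _; [apply: conn | apply: grow].
rewrite sumr_const card_prod card_ord card_bool -[leLHS]mulr_natl.
(* There are 2l bad events, and 2l <= n^2 because 2 <= n and l <= n. *)
apply: le_trans (_ : expR x * expR x * expR (4 * x - y / 3) <= _).
  rewrite ler_wpM2r ?expR_ge0 // -nE -natrM ler_nat; exact: leq_mul.
have cy : 6^-1 * C * x = 6^-1 * y by rewrite /y mulrA.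
rewrite /powR gt_eqF // -!expRD ler_expR -/x mulNr cy; lra.
Qed.
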